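(* Let $Q$ be a smooth manifold, let $\Gamma$ be a SODE in $Q$ and let $q_0$ be a point of $Q$. Then one may find a sufficiently small positive number $h_0$, a family of tangent vectors of $Q$ at $q_0$, $$v_{(h,q_0)}\in T_{q_0}Q,\qquad 0<h\le h_0,$$ and two compact subsets $C$ and $\bar C$ of $Q$ and $TQ$, respectively, with $q_0\in C$ and $v_{(h,q_0)}\in\bar C$, such that (for every $0<h\le h_0$) there exists a unique trajectory of $\Gamma$ $$\sigma_{q_0q_0h}:[0,h]\to C\subseteq Q$$ satisfying $$\sigma_{q_0q_0h}(0)=q_0,\qquad \sigma_{q_0q_0h}(h)=q_0,$$ and $$\dot\sigma_{q_0q_0h}(t)\in\bar C\quad\text{for every } t\in[0,h].$$
   Context: $\tau_Q:TQ\to Q$ is the tangent bundle projection. A SODE (explicit second order differential equation) in $Q$ is a smooth vector field $\Gamma$ on $TQ$ with $(T_v\tau_Q)(\Gamma(v))=v$ for all $v\in TQ$; in local coordinates $(q^i,\dot q^i)$ on $TQ$ it has the form $\Gamma=\dot q^i\,\partial/\partial q^i+\xi^i(q,\dot q)\,\partial/\partial\dot q^i$. A trajectory of $\Gamma$ is a curve $\sigma$ in $Q$ whose velocity curve $\dot\sigma$ in $TQ$ is an integral curve of $\Gamma$, i.e. locally $\ddot q^i=\xi^i(q,\dot q)$. *)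

(* Defs.v *)
From HB Require Import structures.
From mathcomp Require Import all_boot all_order all_algebra.
From mathcomp Require Import all_classical all_reals all_analysis.

Set Implicit Arguments.
Unset Strict Implicit.
Unset Printing Implicit Defensive.

Import Order.TTheory GRing.Theory Num.Theory.
Import numFieldNormedType.Exports.

Local Open Scope classical_set_scope.
Local Open Scope ring_scope.

Section near_diff.
Context {R : realType} {E F : normedModType R}.

Lemma near_eq_diff (f g : E -> F) x : {near x, f =1 g} ->
  differentiable f x -> differentiable g x /\ 'd g x = 'd f x :> (E -> F).
Proof.
move=> fg df; have fgx : f x = g x := nbhs_singleton fg.
have [dc dl] := (diff_locallyP x f).1 df.
have gl : g \o shift x = cst (g x) + 'd f x +o_ 0 id.
  apply/eqaddoP => e e0; move/eqaddoP : dl => /(_ e e0) dl.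
  have fg' : \forall y \near 0, f (y + x) = g (y + x).
    have : (fun y => y + x) @ (0 : E) --> (0 + x)
      by apply: cvgD; [exact: cvg_id|exact: cvg_cst].
    by rewrite add0r => /(_ _ fg).
  near=> y.
  have := near dl y; rewrite -fgx /= => dly.
  rewrite -[(_ - _) y]/(g (y + x) - (f x + 'd f x y)).
  rewrite -(near fg' y) //; first exact: (near dl y).
have dE := diff_unique dc gl.
split; last exact: dE.
by apply/diff_locallyP; rewrite dE; split; [exact: dc|exact: gl].
Unshelve. all: by end_near. Qed.

End near_diff.

Section smoothness.
Context {R : realType}.

(* [Ck k U f] is meaningful for open [U] and finite-dimensional [E], where
   x |-> 'd f x is C^k iff x |-> 'd f x v is C^k for every v. *)
Fixpoint Ck (k : nat) (E F : normedModType R) (U : set E) (f : E -> F) : Prop :=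
  match k with
  | 0 => forall x, U x -> {for x, continuous f}
  | k'.+1 => (forall x, U x -> differentiable f x) /\
             (forall v, Ck k' U (fun x => 'd f x v))
  end.

Definition smooth_on (E F : normedModType R) (U : set E) (f : E -> F) : Prop :=
  forall k, Ck k U f.

End smoothness.

Section smooth_lemmas.
Context {R : realType}.
Implicit Types E F G : normedModType R.

Lemma eq_Ck k E F (U : set E) (f g : E -> F) : open U ->
  (forall x, U x -> f x = g x) -> Ck k U f -> Ck k U g.
Proof.
move=> oU; elim: k f g => [|k IH] f g fg /=.
  move=> cf x Ux; have nfg : {near x, f =1 g}.
    by near=> y; rewrite /= fg //; near: y; exact: open_nbhs_nbhs.
  have gx : g @ x --> f x.
    by apply: cvg_trans (cf x Ux); exact: near_eq_cvg.
  by rewrite fg in gx.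
move=> [df Cf].
have nfg x : U x -> {near x, f =1 g}.
  by move=> Ux; near=> y; rewrite /= fg //; near: y; exact: open_nbhs_nbhs.
split=> [x Ux|v]; first by have [] := near_eq_diff (nfg x Ux) (df x Ux).
apply: IH (Cf v) => x Ux.
by have [_ ->] := near_eq_diff (nfg x Ux) (df x Ux).
Unshelve. all: by end_near. Qed.

Lemma CkS k E F (U : set E) (f : E -> F) : Ck k.+1 U f -> Ck k U f.
Proof.
elim: k f => [|k IH] f [df Cf].
  by move=> x Ux; exact: differentiable_continuous (df x Ux).
by split=> // v; exact: IH.
Qed.

Lemma Ck_cst k E F (U : set E) (c : F) : Ck k U (fun=> c).
Proof.
elim: k c => [|k IH] c /=; first by move=> x _; exact: cvg_cst.
split=> [x _|v]; first exact: (@differentiable_cst R E F c x).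
have -> : (fun x : E => 'd (fun=> c) x v) = (fun=> 0).
  by apply/funext => x; rewrite (diff_cst c x).
exact: IH.
Qed.

Lemma Ck_lin k E F (U : set E) (l : {linear E -> F}) :
  continuous l -> Ck k U l.
Proof.
move=> lc; case: k => [|k] /=; first by move=> x _; exact: lc.
split=> [x _|v]; first exact: linear_differentiable.
have -> : (fun x : E => 'd l x v) = (fun=> l v).
  by apply/funext => x; rewrite diff_lin.
exact: Ck_cst.
Qed.

Lemma Ck_precomp k E F G (U : set F) (f : F -> G) (l : {linear E -> F}) :
  open U -> continuous l -> Ck k U f -> Ck k (l @^-1` U) (f \o l).
Proof.
move=> oU lc; elim: k f => [|k IH] f /=.
  by move=> cf x Ux; apply: continuous_comp; [exact: lc|exact: cf].
move=> [df Cf].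
have dl x : differentiable l x by exact: linear_differentiable.
split=> [x Ux|v]; first by apply: differentiable_comp; [|exact: df].
apply: (@eq_Ck _ _ _ _ ((fun x => 'd f x (l v)) \o l)) => [|x Ux|].
- by apply: open_comp => // x _; exact: lc.
- rewrite [RHS](congr1 (@^~ v) (diff_comp (dl x) (df _ Ux))) /=.
  by rewrite (congr1 (@^~ v) (diff_lin x lc)).
- exact: IH.
Qed.

Lemma CkD k E F (U : set E) (f g : E -> F) : open U ->
  Ck k U f -> Ck k U g -> Ck k U (fun x => f x + g x).
Proof.
move=> oU; elim: k f g => [|k IH] f g /=.
  by move=> cf cg x Ux; apply: cvgD; [exact: cf|exact: cg].
move=> [df Cf] [dg Cg].
split=> [x Ux|v]; first by apply: differentiableD; [exact: df|exact: dg].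
apply: (eq_Ck oU _ (IH _ _ (Cf v) (Cg v))) => x Ux /=.
by rewrite [RHS](congr1 (@^~ v) (diffD (df x Ux) (dg x Ux))).
Qed.

Lemma Ck_sum k E F (U : set E) (m : nat) (f : 'I_m -> E -> F) : open U ->
  (forall i, Ck k U (f i)) -> Ck k U (fun x => \sum_i f i x).
Proof.
move=> oU; elim: m f => [|m IH] f Cf.
  apply: (eq_Ck oU _ (@Ck_cst k E F U 0)) => x _.
  by rewrite big_ord0.
apply: (eq_Ck oU _ (CkD oU (IH _ (fun i => Cf (widen_ord (leqnSn m) i)))
                       (Cf ord_max))) => x _.
by rewrite big_ord_recr.
Qed.

Lemma Ck_pair k E F G (U : set E) (f : E -> F) (g : E -> G) : open U ->
  Ck k U f -> Ck k U g -> Ck k U (fun x => (f x, g x)).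
Proof.
move=> oU; elim: k f g => [|k IH] f g /=.
  by move=> cf cg x Ux; apply: cvg_pair; [exact: cf|exact: cg].
move=> [df Cf] [dg Cg].
split=> [x Ux|v]; first by apply: differentiable_pair; [exact: df|exact: dg].
apply: (eq_Ck oU _ (IH _ _ (Cf v) (Cg v))) => x Ux /=.
by rewrite (congr1 (@^~ v) (diff_pair (df x Ux) (dg x Ux))).
Qed.

Section scale.
Variable F : normedModType R.

Definition scl (a : R) (x : F) : F := a *: x.

Lemma scl_is_bilinear :
  bilinear_for
    (GRing.Scale.Law.clone _ _ *:%R _) (GRing.Scale.Law.clone _ _ *:%R _) scl.
Proof.
split=> [u'|u] a x y; rewrite /scl /=.
- by rewrite scalerDl scalerA.
- by rewrite scalerDr !scalerA mulrC.
Qed.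
HB.instance Definition _ :=
  bilinear_isBilinear.Build R R F F _ _ scl scl_is_bilinear.

Lemma scl_diff (p : R * F) :
  is_diff p (fun q : R * F => scl q.1 q.2) (fun q => scl p.1 q.2 + scl q.1 p.2).
Proof.
have c : continuous (fun q : R * F => scl q.1 q.2) by exact: scale_continuous.
by apply: DiffDef; [exact: differentiable_bilin|rewrite diff_bilin].
Qed.

Lemma diff_scl E (a : E -> R) (f : E -> F) x :
  differentiable a x -> differentiable f x ->
  differentiable (fun y => a y *: f y) x /\
  forall v, 'd (fun y => a y *: f y) x v = a x *: 'd f x v + 'd a x v *: f x.
Proof.
move=> da df.
have dp := differentiable_pair da df.
have [ds1 ds2] := scl_diff (a x, f x).
have -> : (fun y => a y *: f y) =
    (fun q : R * F => scl q.1 q.2) \o (fun y => (a y, f y)) by [].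
split=> [|v]; first exact: differentiable_comp dp ds1.
rewrite [LHS](congr1 (@^~ v) (diff_comp dp ds1)) /=.
by rewrite (congr1 (@^~ v) (diff_pair da df)) (congr1 (@^~ _) ds2).
Qed.

Lemma CkZ k E (U : set E) (a : E -> R) (f : E -> F) : open U ->
  Ck k U a -> Ck k U f -> Ck k U (fun x => a x *: f x).
Proof.
move=> oU; elim: k a f => [|k IH] a f.
  move=> /= ca cf x Ux.
  exact: (@cvgZ R F E (nbhs x) _ a f _ _ (ca x Ux) (cf x Ux)).
move=> Ca' Cf'; have [da Ca] := Ca'; have [df Cf] := Cf'.
split=> [x Ux|v]; first by have [] := diff_scl (da x Ux) (df x Ux).
apply: (@eq_Ck _ _ _ _ (fun x => a x *: 'd f x v + 'd a x v *: f x)) => //.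
  by move=> x Ux; have [_ ->] := diff_scl (da x Ux) (df x Ux).
exact: CkD oU (IH _ _ (CkS Ca') (Cf v)) (IH _ _ (Ca v) (CkS Cf')).
Qed.

End scale.

End smooth_lemmas.

(* A chart is the pair of total functions [chart_map], [chart_inv]; their
   values outside [chart_dom] and its image are irrelevant. *)
Record atlas (R : realType) (E : normedModType R) (M : topologicalType) := Atlas {
  chart_index : Type;
  chart_dom : chart_index -> set M;
  chart_map : chart_index -> M -> E;
  chart_inv : chart_index -> E -> M;
  chart_dom_open : forall i, open (chart_dom i);
  chart_cover : forall x, exists i, chart_dom i x;
  chart_img_open : forall i, open (chart_map i @` chart_dom i);
  chart_mapK : forall i x, chart_dom i x -> chart_inv i (chart_map i x) = x;
  chart_map_cont : forall i x, chart_dom i x ->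
    {for x, continuous (chart_map i)};
  chart_inv_cont : forall i z, (chart_map i @` chart_dom i) z ->
    {for z, continuous (chart_inv i)};
  chart_smooth : forall i j,
    smooth_on (chart_map i @` (chart_dom i `&` chart_dom j))
              (chart_map j \o chart_inv i)
}.

Arguments chart_dom {R E M} A i : rename.
Arguments chart_map {R E M} A i : rename.
Arguments chart_inv {R E M} A i : rename.

Record manifold (R : realType) (n : nat) := Manifold {
  mfd_space :> topologicalType;
  mfd_atlas : atlas 'rV[R]_n mfd_space;
  mfd_hausdorff : hausdorff_space mfd_space;
  mfd_second_countable : @second_countable mfd_space
}.

(* A tangent vector is given by its components in all the charts around its
   base point, related by the Jacobians of the transition maps; the components
   in the other charts are set to 0 so that Leibniz equality is the intended
   equality of tangent vectors. *)
Record tbundle (R : realType) (E : normedModType R) (M : topologicalType)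
    (A : atlas E M) := TVec {
  tbase : M;
  tcomp : chart_index A -> E;
  tcomp_out : forall i, ~ chart_dom A i tbase -> tcomp i = 0;
  tcomp_trans : forall i j, chart_dom A i tbase -> chart_dom A j tbase ->
    tcomp j = 'd (chart_map A j \o chart_inv A i) (chart_map A i tbase) (tcomp i)
}.

Section tangent_bundle.
Context {R : realType} {E : normedModType R} {M : topologicalType}.
Variable A : atlas E M.
Local Notation I := (chart_index A).
Local Notation dom := (chart_dom A).
Local Notation phi := (chart_map A).
Local Notation psi := (chart_inv A).
Local Notation tr i j := (phi j \o psi i).

HB.instance Definition _ := gen_eqMixin (tbundle A).
HB.instance Definition _ := gen_choiceMixin (tbundle A).

Lemma tbundle_ext (v w : tbundle A) :
  tbase v = tbase w -> tcomp v = tcomp w -> v = w.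
Proof.
case: v w => [q c a b] [q' c' a' b'] /= eq ec; subst q' c'.
by congr TVec; exact: Prop_irrelevance.
Qed.

Lemma open_cont_preimage (X Y : topologicalType) (f : X -> Y) (U : set X)
    (V : set Y) : open U -> open V ->
  (forall x, U x -> {for x, continuous f}) -> open (U `&` f @^-1` V).
Proof.
move=> oU oV cf; rewrite openE => x [Ux Vx].
apply: filterI; first exact: open_nbhs_nbhs.
exact: (cf x Ux) (open_nbhs_nbhs (conj oV Vx)).
Qed.

Lemma overlap_open (i : I) (V : set M) : open V ->
  open (phi i @` (dom i `&` V)).
Proof.
move=> oV.
have -> : phi i @` (dom i `&` V) = (phi i @` dom i) `&` psi i @^-1` V.
  apply/seteqP; split=> [z [q [iq Vq] <-]|z [[q iq <-]]] /=.
    by split; [exists q|rewrite /= chart_mapK].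
  by rewrite chart_mapK // => Vq; exists q.
apply: open_cont_preimage => //; first exact: chart_img_open.
exact: chart_inv_cont.
Qed.

Lemma near_overlap (i j : I) q : dom i q -> dom j q ->
  \forall z \near phi i q, (phi i @` (dom i `&` dom j)) z.
Proof.
move=> iq jq; apply: open_nbhs_nbhs; split; last by exists q.
exact/overlap_open/chart_dom_open.
Qed.

Lemma tr_differentiable (i j : I) q : dom i q -> dom j q ->
  differentiable (tr i j) (phi i q).
Proof.
by move=> iq jq; have [+ _] := @chart_smooth _ _ _ A i j 1%N; apply; exists q.
Qed.

Lemma tr_phi (i j : I) q : dom i q -> tr i j (phi i q) = phi j q.
Proof. by move=> iq; rewrite /= chart_mapK. Qed.

Lemma diff_tr_comp (i j k : I) q y : dom i q -> dom j q -> dom k q ->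
  'd (tr j k) (phi j q) ('d (tr i j) (phi i q) y) = 'd (tr i k) (phi i q) y.
Proof.
move=> iq jq kq.
have dij := tr_differentiable iq jq.
have djk : differentiable (tr j k) (tr i j (phi i q)).
  by rewrite tr_phi //; exact: tr_differentiable.
have e : {near phi i q, (tr j k) \o (tr i j) =1 tr i k}.
  have := near_overlap iq jq; apply: filterS => z [p [ip jp] <-].
  by rewrite /= (chart_mapK ip) (chart_mapK jp).
have [_ ->] := near_eq_diff e (differentiable_comp dij djk).
by rewrite [RHS](congr1 (@^~ y) (diff_comp dij djk)) /= (chart_mapK iq).
Qed.

Lemma diff_tr_id (i : I) q y : dom i q -> 'd (tr i i) (phi i q) y = y.
Proof.
move=> iq.
have e : {near phi i q, id =1 tr i i}.
  have := near_overlap iq iq; apply: filterS => z [p [ip _] <-].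
  by rewrite /= (chart_mapK ip).
have [di dE] := is_diff_id (phi i q).
by have [_ ->] := near_eq_diff e di; rewrite (congr1 (@^~ y) dE).
Qed.

Section tvec_at.
Variables (i : I) (q : M) (y : E).

Definition tvec_at_comp (j : I) : E :=
  if `[< dom i q /\ dom j q >] then 'd (tr i j) (phi i q) y else 0.

Lemma tvec_at_out j : ~ dom j q -> tvec_at_comp j = 0.
Proof. by move=> jq; rewrite /tvec_at_comp asboolF // => -[]. Qed.

Lemma tvec_at_trans j k : dom j q -> dom k q ->
  tvec_at_comp k = 'd (tr j k) (phi j q) (tvec_at_comp j).
Proof.
move=> jq kq; rewrite /tvec_at_comp.
have [iq|iq] := pselect (dom i q).
  by rewrite !asboolT // diff_tr_comp.
by rewrite !asboolF ?linear0 // => -[].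
Qed.

(* The vector at [q] with component [y] in chart [i] (0 if [q] is not in the
   domain of [i]). *)
Definition tvec_at : tbundle A := TVec tvec_at_out tvec_at_trans.

Lemma tvec_atE : dom i q -> tcomp tvec_at i = y.
Proof.
by move=> iq; rewrite /= /tvec_at_comp asboolT // diff_tr_id.
Qed.

End tvec_at.

Definition tdom (i : I) : set (tbundle A) := @tbase _ _ _ A @^-1` dom i.
Definition tmap (i : I) (v : tbundle A) : E * E := (phi i (tbase v), tcomp v i).
Definition tinv (i : I) (z : E * E) : tbundle A := tvec_at i (psi i z.1) z.2.

Lemma tmapK i v : tdom i v -> tinv i (tmap i v) = v.
Proof.
move=> iv; apply: tbundle_ext => /=; first exact: chart_mapK.
apply/funext => j; rewrite /tvec_at_comp (chart_mapK iv).
have [jv|jv] := pselect (dom j (tbase v)).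
  by rewrite asboolT // -tcomp_trans.
by rewrite asboolF ?tcomp_out // => -[].
Qed.

Lemma tinvK i z : (phi i @` dom i) z.1 ->
  tdom i (tinv i z) /\ tmap i (tinv i z) = z.
Proof.
case: z => x y [q iq /= qx].
have iq' : dom i (psi i x) by rewrite -qx (chart_mapK iq).
split; first exact: iq'.
rewrite /tmap tvec_atE // -[tbase _]/(psi i x).
by rewrite -qx (chart_mapK iq).
Qed.

Definition topen (W : set (tbundle A)) : Prop :=
  forall i, open (tmap i @` (W `&` tdom i)).

Lemma tmap_imageE i W :
  tmap i @` (W `&` tdom i) =
  ((phi i @` dom i) \o fst) `&` (tinv i @^-1` W).
Proof.
apply/seteqP; split=> [z [v [Wv iv] <-]|z [/= iz Wz]].
  by split; [exists (tbase v)|rewrite /= tmapK].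
by have [? ?] := tinvK iz; exists (tinv i z).
Qed.

Lemma open_fst (U : set E) : open U -> open ((U : set E) \o (@fst E E)).
Proof.
move=> oU; rewrite -[X in open X]/(fst @^-1` U).
by apply: open_comp => // z _; exact: cvg_fst.
Qed.

Lemma topenT : topen setT.
Proof.
move=> i; rewrite tmap_imageE preimage_setT setIT.
exact/open_fst/chart_img_open.
Qed.

Lemma topenI (V W : set (tbundle A)) : topen V -> topen W -> topen (V `&` W).
Proof.
move=> oV oW i; move: (oV i) (oW i); rewrite !tmap_imageE => oVi oWi.
by rewrite preimage_setI setIIr; exact: openI.
Qed.

Lemma topen_bigU (J : Type) (f : J -> set (tbundle A)) :
  (forall j, topen (f j)) -> topen (\bigcup_j f j).
Proof.
move=> of_ i; rewrite tmap_imageE preimage_bigcup setI_bigcupr.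
by apply: bigcup_open => j _; rewrite -tmap_imageE; exact: of_.
Qed.

HB.instance Definition _ :=
  @isOpenTopological.Build (tbundle A) topen topenT topenI topen_bigU.

End tangent_bundle.

Section tangent_atlas.
Context {R : realType} {n : nat} {M : topologicalType}.
Variable A : atlas 'rV[R]_n M.
Local Notation E := 'rV[R]_n.
Local Notation I := (chart_index A).
Local Notation dom := (chart_dom A).
Local Notation phi := (chart_map A).
Local Notation psi := (chart_inv A).
Local Notation tr i j := (phi j \o psi i).

Lemma topenE (W : set (tbundle A)) : open W = topen W.
Proof. by []. Qed.

Lemma tdom_open (i : I) : open (@tdom _ _ _ A i).
Proof.
rewrite topenE => j; rewrite tmap_imageE.
have -> : ((phi j @` dom j) \o fst) `&` (tinv j @^-1` tdom i) =
   (phi j @` (dom j `&` dom i)) \o (@fst E E).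
  apply/seteqP; split=> [z [/= [q jq qz]]|z /= [q [jq iq] qz]].
    by rewrite /tdom /= -qz (chart_mapK jq) => iq; exists q.
  by split; [exists q|rewrite /tdom /= -qz (chart_mapK jq)].
exact/open_fst/overlap_open/chart_dom_open.
Qed.

Lemma tdom_cover (v : tbundle A) : exists i, tdom i v.
Proof. exact: chart_cover. Qed.

Lemma timg_open (i : I) : open (@tmap _ _ _ A i @` tdom i).
Proof. by have := @topenT _ _ _ A i; rewrite setTI. Qed.

Lemma toverlapE (i j : I) :
  tmap i @` (@tdom _ _ _ A i `&` tdom j) =
  (phi i @` (dom i `&` dom j)) \o (@fst E E).
Proof.
apply/seteqP; split=> [z [v [iv jv] <-]|z [q [iq jq] qz]].
  by exists (tbase v).
have [|iz zE] := @tinvK _ _ _ A i z; first by exists q.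
exists (tinv i z) => //; split=> //.
by rewrite /tdom /= -qz (chart_mapK iq).
Qed.

Lemma tr_tangent_smooth (i j : I) :
  smooth_on (tmap i @` (@tdom _ _ _ A i `&` tdom j)) (tmap j \o tinv i).
Proof.
move=> k; rewrite toverlapE.
set U := phi i @` (dom i `&` dom j).
have oU : open U by exact/overlap_open/chart_dom_open.
have oU' : open (U \o (@fst E E)) by exact: open_fst.
pose fstL : {linear (E * E)%type -> E} := [the {linear _ -> _} of @fst E E].
pose coordf (l : 'I_n) (z : E * E) : R := z.2 0 l.
have coord_lin l : linear (coordf l).
  by move=> a x y; rewrite /coordf /= !mxE.
pose coordM l := GRing.isLinear.Build _ _ _ _ _ (coord_lin l).
pose coordL l : {linear (E * E)%type -> R} := HB.pack (coordf l) (coordM l).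
have cfst : continuous fstL by move=> z; exact: cvg_fst.
have ccoord l : continuous (coordL l).
  move=> z; apply: (@continuous_comp _ _ _ (@snd E E) (fun y : E => y 0 l)).
    exact: cvg_snd.
  exact: coord_continuous.
have Ctr := @chart_smooth _ _ _ A i j.
apply: (@eq_Ck _ _ _ _ _ (fun z => (tr i j (fstL z),
    \sum_l coordL l z *: ((fun x => 'd (tr i j) x 'e_l) \o fstL) z))) => //.
  move=> z [q [iq jq] qz]; rewrite /tmap /tinv /=; congr pair.
  rewrite /tvec_at_comp asboolT; last by rewrite -qz (chart_mapK iq).
  rewrite -qz (chart_mapK iq) [in RHS](row_sum_delta z.2) linear_sum /=.
  by apply: eq_bigr => l _; rewrite linearZ.
apply: Ck_pair => //; first exact: (Ck_precomp oU cfst (Ctr k)).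
apply: Ck_sum => // l; apply: CkZ => //; first exact: Ck_lin.
by apply: (Ck_precomp oU cfst); have [_ +] := Ctr k.+1; apply.
Qed.

Lemma tmap_cont (i : I) (v : tbundle A) : tdom i v ->
  {for v, continuous (tmap i)}.
Proof.
move=> iv O /=; rewrite nbhsE => -[V [oV Vv] VO].
have oW : open (tdom i `&` tmap i @^-1` V).
  rewrite topenE => j.
  have -> : tmap j @` ((tdom i `&` tmap i @^-1` V) `&` tdom j) =
      (tmap j @` (tdom j `&` tdom i)) `&` (tmap i \o tinv j) @^-1` V.
    apply/seteqP; split=> [z [w [[iw Vw] jw] <-]|z [[w [jw iw] <-]]] /=.
      by split; [exists w|rewrite /= tmapK].
    by rewrite tmapK // => Vw; exists w.
  apply: (open_cont_preimage _ oV (tr_tangent_smooth j i 0)).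
  by rewrite toverlapE; exact/open_fst/overlap_open/chart_dom_open.
apply: (filterS _ (open_nbhs_nbhs (conj oW _))); last by split.
by move=> w [_ Vw]; exact: VO.
Qed.

Lemma tinv_cont (i : I) z : (@tmap _ _ _ A i @` tdom i) z ->
  {for z, continuous (@tinv _ _ _ A i)}.
Proof.
move=> [v iv vz] W /=; rewrite nbhsE => -[V [oV Vz] VW].
have oVi : open (tmap i @` (V `&` tdom i)) by exact: oV.
apply: (filterS _ (open_nbhs_nbhs (conj oVi _))).
  by rewrite tmap_imageE => x [_ Vx]; exact: VW.
by rewrite tmap_imageE; split=> //; exists (tbase v) => //; rewrite -vz.
Qed.

Definition tatlas : atlas (E * E)%type (tbundle A) :=
  @Atlas R (E * E)%type (tbundle A) I (@tdom _ _ _ A) (@tmap _ _ _ A)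
    (@tinv _ _ _ A) tdom_open tdom_cover timg_open (@tmapK _ _ _ A)
    tmap_cont tinv_cont tr_tangent_smooth.

End tangent_atlas.

Section vector_fields.
Context {R : realType} {E : normedModType R} {M : topologicalType}.

Definition smooth_vector_field (A : atlas E M) (X : M -> tbundle A) : Prop :=
  (forall x, tbase (X x) = x) /\
  (forall i, smooth_on (chart_map A i @` chart_dom A i)
               (fun z => tcomp (X (chart_inv A i z)) i)).

(* [v] is the image of [w] under the tangent map of [f] at [tbase w]. *)
Definition is_tangent_image (E' : normedModType R) (M' : topologicalType)
    (A : atlas E M) (A' : atlas E' M') (f : M -> M')
    (w : tbundle A) (v : tbundle A') : Prop :=
  tbase v = f (tbase w) /\
  (forall i j, chart_dom A i (tbase w) -> chart_dom A' j (f (tbase w)) ->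
     tcomp v j = 'd (chart_map A' j \o f \o chart_inv A i)
                    (chart_map A i (tbase w)) (tcomp w i)).

(* [v] is the velocity at time [t] of the curve [c] defined on [J]; the
   derivative is one-sided at the end points of [J]. *)
Definition is_velocity (A : atlas E M) (J : set R) (c : R -> M) (t : R)
    (v : tbundle A) : Prop :=
  [/\ tbase v = c t,
      c s @[s --> within J (nbhs t)] --> c t &
      forall i, chart_dom A i (c t) ->
        (s - t)^-1 *: (chart_map A i (c s) - chart_map A i (c t))
          @[s --> within J t^'] --> tcomp v i].

Definition integral_curve (A : atlas E M) (X : M -> tbundle A) (J : set R)
    (c : R -> M) : Prop :=
  forall t, J t -> is_velocity J c t (X (c t)).

End vector_fields.

Section sode.
Context {R : realType} {n : nat}.

Definition tangent (Q : manifold R n) : topologicalType :=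
  tbundle (mfd_atlas Q).

Definition tangent_proj (Q : manifold R n) (v : tangent Q) : Q := tbase v.

Definition tangent_atlas (Q : manifold R n) :
  atlas ('rV[R]_n * 'rV[R]_n)%type (tangent Q) := tatlas (mfd_atlas Q).

Definition is_SODE (Q : manifold R n)
    (Gamma : tangent Q -> tbundle (tangent_atlas Q)) : Prop :=
  smooth_vector_field Gamma /\
  (forall v : tangent Q, is_tangent_image (@tangent_proj Q) (Gamma v) v).

Definition velocity_curve (Q : manifold R n) (J : set R) (sigma : R -> Q)
    (dsigma : R -> tangent Q) : Prop :=
  forall t, J t -> is_velocity J sigma t (dsigma t).

Definition trajectory (Q : manifold R n)
    (Gamma : tangent Q -> tbundle (tangent_atlas Q)) (J : set R)
    (sigma : R -> Q) : Prop :=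
  exists2 dsigma : R -> tangent Q,
    velocity_curve J sigma dsigma & integral_curve Gamma J dsigma.

Definition loop_trajectory (Q : manifold R n)
    (Gamma : tangent Q -> tbundle (tangent_atlas Q)) (q0 : Q)
    (C : set Q) (Cbar : set (tangent Q)) (h : R) (sigma : R -> Q) : Prop :=
  [/\ trajectory Gamma `[0, h] sigma,
      forall t, t \in `[0, h] -> C (sigma t),
      sigma 0 = q0,
      sigma h = q0 &
      exists2 dsigma : R -> tangent Q,
        velocity_curve `[0, h] sigma dsigma &
        forall t, t \in `[0, h] -> Cbar (dsigma t)].

End sode.

(* Main.v *)
From HB Require Import structures.
Require Import Defs.
From mathcomp Require Import all_boot all_order all_algebra.
From mathcomp Require Import all_classical all_reals all_analysis.
From mathcomp Require Import lra.

(* In a chart around q0 a trajectory is a solution of x'' = f(x, x'), where f is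
   bounded by K and L-Lipschitz on a small closed ball around (x0, 0). If a curve
   z on [0, h] returns to its starting point, Rolle's theorem makes each
   coordinate of z' vanish somewhere, so |z''| <= M gives |z'| <= M h and
   |z - z(0)| <= M h^2. Hence for h small the map sending an acceleration a to
   f(x, x'), where x'' = a and x(0) = x(h) = x0, preserves |a| <= K and contracts
   by 1/2: its fixed point is the wanted loop. The same estimate applied to the
   difference of two loops staying in the ball gives uniqueness. *)

Set Implicit Arguments.
Unset Strict Implicit.
Unset Printing Implicit Defensive.

Import Order.TTheory GRing.Theory Num.Theory.
Import numFieldNormedType.Exports.

Local Open Scope classical_set_scope.
Local Open Scope ring_scope.

(** * Derivatives relative to an interval *)

Section relative_derivative.
Context {R : realType}.
Implicit Types (V : normedModType R) (J : set R).

(* One-sided at the end points of an interval [J]. *)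
Definition wderiv V J (u : R -> V) (t : R) (l : V) : Prop :=
  (s - t)^-1 *: (u s - u t) @[s --> within J t^'] --> l.

#[local] Instance within_dnbhs_filter J (t : R) : Filter (within J t^').
Proof. exact: within_filter. Qed.

Lemma wderiv_continuous V J (u : R -> V) t l :
  wderiv J u t l -> u s @[s --> within J (nbhs t)] --> u t.
Proof.
move=> ul.
(* Off [t], [u s] equals [s - t] times the difference quotient plus [u t], and the quotient has a
   limit. The point [s = t], excluded by this filter, is treated apart below. *)
have h1 : (s - t) *: ((s - t)^-1 *: (u s - u t)) + u t @[s --> within J t^']
    --> (t - t) *: l + u t.
  apply: cvgD; last exact: cvg_cst.
  apply: cvgZ ul.
  apply: cvgB; last exact: cvg_cst.
  by apply: cvg_trans (cvg_within _) _; exact: nbhs_dnbhs.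
rewrite subrr scale0r add0r in h1.
move=> A /= uA; have := h1 _ uA.
move=> H; change (nbhs t (fun s => J s -> A (u s))).
apply: (@filterS _ _ _ (fun s => s != t -> J s ->
  A ((s - t) *: ((s - t)^-1 *: (u s - u t)) + u t))); last exact: H.
move=> s H' Js.
have [->|st] := eqVneq s t; first exact: nbhs_singleton.
by have := H' st Js; rewrite scalerA divff ?subr_eq0// scale1r subrK.
Qed.

Lemma is_derive_wderiv V J (u : R -> V) t l :
  is_derive t (1 : R) u l -> wderiv J u t l.
Proof.
move=> [du dE].
have : (fun h => h^-1 *: (u (h *: 1 + t) - u t)) @ 0^' --> l by rewrite -dE.
have : (fun s => s - t) @ within J t^' --> (0 : R)^'.
  move=> A; rewrite /dnbhs /within /= !near_simpl => A0.
  have : (fun s => s - t) @ t --> (t - t).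
    by apply: cvgB; [exact: cvg_id|exact: cvg_cst].
  rewrite subrr => /(_ _ A0); rewrite /= !near_simpl; apply: filterS => s As st _.
  by apply: As; rewrite subr_eq0.
move=> h1 h2; have := cvg_comp _ _ h1 h2; apply: cvg_trans.
apply: near_eq_cvg; apply: nearW => s /=.
by rewrite [(s - t) *: 1]mulr1 subrK.
Qed.

Lemma wderiv_interior V J (u : R -> V) t l :
  nbhs t J -> wderiv J u t l -> is_derive t (1 : R) u l.
Proof.
move=> Jt ul.
suff h : (fun h => h^-1 *: (u (h *: 1 + t) - u t)) @ 0^' --> l.
  split; first by apply/cvg_ex; exists l.
  by apply: cvg_lim h; exact: norm_hausdorff.
have : (fun h : R => h + t) @ 0^' --> within J t^'.
  move=> A; rewrite /dnbhs /within /= !near_simpl => A0.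
  have : (fun s => s + t) @ (0 : R) --> (0 + t).
    by apply: cvgD; [exact: cvg_id|exact: cvg_cst].
  rewrite add0r => ct.
  have h1 := ct _ Jt; have h2 := ct _ A0; move: h1 h2.
  rewrite /= !near_simpl; apply: filterS2 => s Js As s0.
  by apply: As => //; rewrite -subr_eq0 addrK.
move=> h1; have := cvg_comp _ _ h1 ul; apply: cvg_trans.
apply: near_eq_cvg; apply: nearW => s /=.
by rewrite [s *: 1]mulr1 addrK.
Qed.

Lemma wderivB V J (u v : R -> V) t l k :
  wderiv J u t l -> wderiv J v t k -> wderiv J (u \- v) t (l - k).
Proof.
move=> ul vk; apply: cvg_trans (cvgB ul vk).
apply: near_eq_cvg; apply: nearW => s /=.
rewrite -[LHS]/((s - t)^-1 *: (u s - u t) - (s - t)^-1 *: (v s - v t)).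
rewrite -scalerBr /=; congr (_ *: _).
by rewrite !opprB addrACA [RHS]addrACA [in RHS](addrC (- v s)).
Qed.

Lemma wderiv_linear V (W : normedModType R) J (f : {linear V -> W})
    (u : R -> V) t l :
  continuous f -> wderiv J u t l -> wderiv J (f \o u) t (f l).
Proof.
move=> cf ul; have := cvg_comp _ _ ul (cf l); apply: cvg_trans.
by apply: near_eq_cvg; apply: nearW => s /=; rewrite linearZ linearB.
Qed.

(** Limits in a Hausdorff space are unique along a proper filter. Properness holds because [0 < h]
    makes every [t] of the interval an accumulation point: nearby points lie to its right if
    [t < h], to its left otherwise. *)
Lemma wderiv_unique V (h : R) (u : R -> V) t l k : 0 < h -> t \in `[0, h] ->
  wderiv `[0, h] u t l -> wderiv `[0, h] u t k -> l = k.
Proof.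
move=> h0; rewrite in_itv/= => /andP[t0 th] ul uk.
suff PF : ProperFilter (within `[0, h]%classic t^').
  exact: (cvg_unique (@norm_hausdorff _ V) ul uk).
split; last exact: within_filter.
move=> H0.
have /nbhs_ballP[e /= e0 H] : nbhs t (fun s => s != t -> `[0, h]%classic s -> False).
  exact: H0.
have [th'|th'] := ltP t h.
- pose s := t + Num.min (e / 2) (h - t).
  have m0 : 0 < Num.min (e / 2) (h - t) by rewrite lt_min divr_gt0 //= subr_gt0.
  apply: (H s) => /=.
  + rewrite /ball/= /s opprD addNKr normrN gtr0_norm//.
    by rewrite gt_min ltr_pdivrMr// ltr_pMr// ltr1n.
  + by rewrite /s -subr_eq0 addrC addKr gt_eqF.
  + rewrite in_itv/= /s addr_ge0//=; last exact: ltW.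
    by rewrite addrC -lerBrDr ge_min lexx orbT.
- pose s := t - Num.min (e / 2) t.
  have tp : 0 < t by exact: lt_le_trans h0 th'.
  have m0 : 0 < Num.min (e / 2) t by rewrite lt_min divr_gt0.
  apply: (H s) => /=.
  + rewrite /ball/= /s opprB addrCA subrr addr0 gtr0_norm//.
    by rewrite gt_min ltr_pdivrMr// ltr_pMr// ltr1n.
  + by rewrite /s -subr_eq0 addrC addKr oppr_eq0 gt_eqF.
  + rewrite in_itv/= /s subr_ge0 ge_min lexx orbT/=.
    by rewrite lerBlDr (le_trans th)// lerDl ltW.
Qed.

(** * Rolle and mean value theorems for scalar functions *)

Section scalar.
Variables (h : R) (f g : R -> R).
Hypothesis fg : forall t, t \in `[0, h] -> wderiv `[0, h] f t (g t).

Let fcont : {within `[0, h], continuous f}.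
Proof. by apply/subspace_continuousP => t th; exact: wderiv_continuous (fg _). Qed.

Let fderive t : t \in `]0, h[ -> is_derive t (1 : R) f (g t).
Proof.
move=> th; apply: (@wderiv_interior R^o `[0, h]%classic); last first.
  by apply: fg; exact: subset_itv_oo_cc th.
apply: (@filterS _ _ _ `]0, h[%classic); first exact: subset_itv_oo_cc.
exact: near_in_itvoo.
Qed.

Lemma wderiv_rolle : 0 < h -> f 0 = f h -> exists2 c, c \in `[0, h] & g c = 0.
Proof.
move=> h0 f0h; have [c ch dc] : exists2 c, c \in `]0, h[ & is_derive c (1 : R) f 0.
  by apply: Rolle => // t th; have [] := fderive th.
exists c; first exact: subset_itv_oo_cc ch.
have [_ <-] := fderive ch; by have [_ ->] := dc.
Qed.

(** The mean value theorem on [[s, t]], with [t - s] bounded by [h]. One-sided derivatives at the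
    ends suffice, since they give continuity there. *)
Lemma wderiv_lipschitz (M : R) : (forall t, t \in `[0, h] -> `|g t| <= M) ->
  forall s t, s \in `[0, h] -> t \in `[0, h] -> `|f s - f t| <= M * h.
Proof.
move=> gM.
suff H s t : s \in `[0, h] -> t \in `[0, h] -> s < t -> `|f s - f t| <= M * h.
  move=> s t sh th; have [st|st|->] := ltgtP s t; first exact: H.
    by rewrite distrC; exact: H.
  rewrite subrr normr0 mulr_ge0//; first exact: le_trans (gM _ th).
  by move: th; rewrite in_itv/= => /andP[]; exact: le_trans.
rewrite !in_itv/= => /andP[s0 sh] /andP[t0 th] st.
have sub : `[s, t] `<=` `[0, h].
  by move=> x; rewrite /= !in_itv/= => /andP[sx xt];
    rewrite (le_trans s0)// (le_trans xt).
have [||c ch E] := @MVT _ f g s t st.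
- move=> x; rewrite in_itv/= => /andP[sx xt]; apply: fderive.
  by rewrite in_itv/= (le_lt_trans s0)// (lt_le_trans xt).
- exact: continuous_subspaceW fcont.
rewrite distrC E normrM ler_pM//; first by apply/gM/sub/subset_itv_oo_cc.
by rewrite gtr0_norm ?subr_gt0// lerBlDr (le_trans th)// lerDl.
Qed.

End scalar.

(** * Coordinatewise estimates for curves in ['rV[R]_n] *)

Section vector.
Variable n : nat.
Local Notation E := 'rV[R]_n.

(** The norm is the maximum of the coordinates, which is 0 for [n = 0]; hence the assumption
    [0 <= M]. *)
Lemma rV_norm_le (x : E) (M : R) : 0 <= M ->
  (forall i, `|x 0 i| <= M) -> `|x| <= M.
Proof.
move=> M0 xM; rewrite [leLHS]/Num.norm/= mx_normrE; apply/bigmax_leP; split=> //.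
by case=> i j _ /=; rewrite ord1.
Qed.

Lemma rV_coord_le (x : E) i : `|x 0 i| <= `|x|.
Proof.
rewrite [leRHS]/Num.norm/= mx_normrE.
exact: (le_bigmax _ (fun ij : 'I_1 * 'I_n => `|x ij.1 ij.2|) (0, i)).
Qed.

Definition coordf (i : 'I_n) (x : E) : R^o := x 0 i.

Lemma coordf_is_linear i : linear (coordf i).
Proof. by move=> a x y; rewrite /coordf !mxE. Qed.

HB.instance Definition _ i := GRing.isLinear.Build _ _ _ _ (coordf i)
  (coordf_is_linear i).

Lemma coordf_continuous i : continuous (coordf i).
Proof. exact: coord_continuous. Qed.

(* Rolle's theorem makes every coordinate of the velocity vanish somewhere. *)
Lemma loop_bounds (h M : R) (z w a : R -> E) : 0 < h ->
  (forall t, t \in `[0, h] -> wderiv `[0, h] z t (w t)) ->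
  (forall t, t \in `[0, h] -> wderiv `[0, h] w t (a t)) ->
  z 0 = z h -> (forall t, t \in `[0, h] -> `|a t| <= M) ->
  forall t, t \in `[0, h] -> `|w t| <= M * h /\ `|z t - z 0| <= M * h * h.
Proof.
move=> h0 zw wa z0h aM.
have h00 : 0 \in `[0, h] by rewrite in_itv/= lexx ltW.
have M0 : 0 <= M by apply: le_trans (aM _ h00).
have Mh0 : 0 <= M * h by rewrite mulr_ge0// ltW.
have wM t : t \in `[0, h] -> `|w t| <= M * h.
  move=> th; apply: rV_norm_le => // i.
  have [c ch wc] : exists2 c, c \in `[0, h] & coordf i (w c) = 0.
    apply: (@wderiv_rolle h (coordf i \o z)) => //; last by rewrite /= z0h.
    by move=> s sh; apply: wderiv_linear; [exact: coordf_continuous|exact: zw].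
  rewrite -[w t 0 i]subr0 -[X in _ - X]wc.
  apply: (@wderiv_lipschitz h (coordf i \o w) (coordf i \o a)) => // s sh.
    by apply: wderiv_linear; [exact: coordf_continuous|exact: wa].
  by apply: le_trans (rV_coord_le _ _) _; exact: aM.
move=> t th; split; first exact: wM.
apply: rV_norm_le => [|i]; first by rewrite mulr_ge0// ltW.
rewrite !mxE.
apply: (@wderiv_lipschitz h (coordf i \o z) (coordf i \o w)) => // s sh.
  by apply: wderiv_linear; [exact: coordf_continuous|exact: zw].
by apply: le_trans (rV_coord_le _ _) _; exact: wM.
Qed.

End vector.
End relative_derivative.

(** * Local Lipschitz bounds *)

Section lipschitz.
Context {R : realType}.

(** The difference quotient of the restriction to the line is the directional quotient of [f] along
    [v]. *)
Lemma wderiv_segment (V W : normedModType R) J (f : V -> W) p v s :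
  differentiable f (p + s *: v) ->
  wderiv J (fun t : R => f (p + t *: v)) s ('d f (p + s *: v) v).
Proof.
move=> df; apply: is_derive_wderiv.
set G := fun t : R => f (p + t *: v).
have E : (fun h : R => h^-1 *: (f (h *: v + (p + s *: v)) - f (p + s *: v))) =
   (fun h : R => h^-1 *: (G (h *: 1 + s) - G s)).
  by apply/funext => h; rewrite /G [h *: 1]mulr1 scalerDl addrCA.
split; first by have := diff_derivable (v := v) df; rewrite /derivable E.
by rewrite /derive -E -deriveE.
Qed.

(** [Ck 1] gives continuity of the differential only one direction at a time. A finite spanning
    family [e] with coordinates bounded by the norm turns this into a uniform bound on the
    differential, and the mean value theorem on segments concludes. *)
Lemma C1_locally_lipschitz (V : normedModType R) (n : nat) (I : finType)
    (e : I -> V) (c : V -> I -> R) (U : set V) (f : V -> 'rV[R]_n) z0 :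
  (forall v, v = \sum_i c v i *: e i) -> (forall v i, `|c v i| <= `|v|) ->
  open U -> U z0 -> Ck 1 U f ->
  exists r K L : R,
    [/\ [/\ 0 < r, 0 <= K & 0 <= L],
        forall z, `|z - z0| <= r -> U z,
        forall z, `|z - z0| <= r -> `|f z| <= K &
        forall z w, `|z - z0| <= r -> `|w - z0| <= r ->
          `|f z - f w| <= L * `|z - w| ].
Proof.
move=> ce cle oU Uz0 Cf; have [df cdf] := Cf.
have cf : {for z0, continuous f} by exact: differentiable_continuous (df _ Uz0).
have nK : \forall z \near z0, `|f z| <= `|f z0| + 1.
  have : `|f z| @[z --> z0] --> `|f z0| by exact: cvg_norm.
  move=> /cvgr_le /(_ (`|f z0| + 1)); apply; by rewrite ltrDl.
have nL : \forall z \near z0, forall i, `|'d f z (e i)| <= `|'d f z0 (e i)| + 1.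
  apply: filter_forall => i.
  have : `|'d f z (e i)| @[z --> z0] --> `|'d f z0 (e i)|.
    by apply: cvg_norm; exact: cdf.
  move=> /cvgr_le /(_ (`|'d f z0 (e i)| + 1)); apply; by rewrite ltrDl.
have : \forall z \near z0, [/\ U z, `|f z| <= `|f z0| + 1 &
    forall i, `|'d f z (e i)| <= `|'d f z0 (e i)| + 1].
  near=> z; split.
  - near: z; exact: open_nbhs_nbhs.
  - by near: z.
  - by near: z.
move=> /nbhs_normP[r /= r0 Hr].
pose L := \sum_i (`|'d f z0 (e i)| + 1).
have L0 : 0 <= L by apply: sumr_ge0 => i _; rewrite addr_ge0.
(* Halving the radius puts a closed ball inside the open one. *)
have {}Hr z : `|z - z0| <= r / 2 -> [/\ U z, `|f z| <= `|f z0| + 1 &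
    forall i, `|'d f z (e i)| <= `|'d f z0 (e i)| + 1].
  move=> zr; apply: Hr; rewrite /= distrC (le_lt_trans zr)//.
  by rewrite ltr_pdivrMr// ltr_pMr// ltr1n.
exists (r / 2), (`|f z0| + 1), L; split.
- by split=> //; rewrite divr_gt0.
- by move=> z /Hr[].
- by move=> z /Hr[].
move=> z w zr wr; set v := z - w.
(* [G] runs from [f w] to [f z] along a segment that stays in the ball by convexity. *)
pose G (t : R) := f (w + t *: v).
have inball t : t \in `[0, 1] -> `|w + t *: v - z0| <= r / 2.
  rewrite in_itv/= => /andP[t0 t1].
  have -> : w + t *: v - z0 = (1 - t) *: (w - z0) + t *: (z - z0).
    rewrite scalerBl scale1r -[RHS]addrA [- (t *: _) + _]addrC -scalerBr opprB.
    by rewrite [z - z0 + _]addrA subrK addrAC.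
  apply: le_trans (ler_normD _ _) _; rewrite !normrZ ger0_norm ?subr_ge0//.
  rewrite (ger0_norm t0) -[leRHS]mul1r -[X in X * (r / 2)](subrK t) [leRHS]mulrDl.
  by rewrite lerD// ler_wpM2l// subr_ge0.
have dG t : t \in `[0, 1] -> wderiv `[0, 1] G t ('d f (w + t *: v) v).
  move=> t01; apply: wderiv_segment; apply: df.
  by have [] := Hr _ (inball _ t01).
have dle t : t \in `[0, 1] -> `|'d f (w + t *: v) v| <= L * `|v|.
  move=> t01; have [_ _ di] := Hr _ (inball _ t01).
  have -> : 'd f (w + t *: v) v = 'd f (w + t *: v) (\sum_i c v i *: e i).
    by rewrite -ce.
  rewrite linear_sum/=.
  apply: le_trans (ler_norm_sum _ _ _) _.
  rewrite /L mulr_suml; apply: ler_sum => i _.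
  rewrite linearZ/= normrZ mulrC; apply: ler_pM => //; exact: cle.
apply: rV_norm_le => [|i]; first by rewrite mulr_ge0.
have := @wderiv_lipschitz _ 1 (coordf i \o G)
  (fun t => coordf i ('d f (w + t *: v) v)) _ (L * `|v|) _ 1 0.
rewrite mulr1 /= /G scale1r scale0r addr0 addrCA subrr addr0 /coordf.
rewrite !mxE; apply.
- move=> t t01; apply: (@wderiv_linear _ _ _ _ (coordf i)).
    exact: coordf_continuous.
  exact: dG.
- move=> t t01; apply: le_trans (rV_coord_le _ _) _; exact: dle.
- by rewrite in_itv/= ler01 lexx.
- by rewrite in_itv/= ler01 lexx.
Unshelve. all: by end_near. Qed.

Lemma C1_locally_lipschitz2 (n : nat) (U : set ('rV[R]_n * 'rV[R]_n))
    (f : 'rV[R]_n * 'rV[R]_n -> 'rV[R]_n) z0 :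
  open U -> U z0 -> Ck 1 U f ->
  exists r K L : R,
    [/\ [/\ 0 < r, 0 <= K & 0 <= L],
        forall z, `|z - z0| <= r -> U z,
        forall z, `|z - z0| <= r -> `|f z| <= K &
        forall z w, `|z - z0| <= r -> `|w - z0| <= r ->
          `|f z - f w| <= L * `|z - w| ].
Proof.
pose e (i : 'I_n + 'I_n) : 'rV[R]_n * 'rV[R]_n :=
  match i with inl k => ('e_k, 0) | inr k => (0, 'e_k) end.
pose c (v : 'rV[R]_n * 'rV[R]_n) (i : 'I_n + 'I_n) :=
  match i with inl k => v.1 0 k | inr k => v.2 0 k end.
apply: (@C1_locally_lipschitz _ _ _ e c).
- move=> v; rewrite big_sumType/= /e /c/=.
  have fst_sum (F : 'I_n -> 'rV[R]_n * 'rV[R]_n) : (\sum_i F i).1 = \sum_i (F i).1.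
    by rewrite (raddf_sum (@fst 'rV[R]_n 'rV[R]_n)).
  have snd_sum (F : 'I_n -> 'rV[R]_n * 'rV[R]_n) : (\sum_i F i).2 = \sum_i (F i).2.
    by rewrite (raddf_sum (@snd 'rV[R]_n 'rV[R]_n)).
  rewrite [LHS]surjective_pairing; congr pair => /=.
  + rewrite fst_sum/= fst_sum/= [X in _ + X]big1 ?addr0 => [|i _];
      last by rewrite scaler0.
    exact: row_sum_delta.
  + rewrite snd_sum/= snd_sum/= [X in X + _]big1 ?add0r => [|i _];
      last by rewrite scaler0.
    exact: row_sum_delta.
- by move=> v [i|i] /=; apply: le_trans (rV_coord_le _ _) _;
    rewrite [leRHS]prod_normE le_max lexx ?orbT.
Qed.

End lipschitz.

(** * The boundary value problem x'' = f(x, x'), x(0) = x(h) = x0 *)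

Section bvp.
Context {R : realType}.

Lemma antiderivative (h : R) (f : R -> R) : 0 < h -> continuous f ->
  exists F : R -> R, forall t, t \in `[0, h] -> is_derive t (1 : R) F (f t).
Proof.
move=> h0 cf.
(* Integrating from -1, inside an interval that ends at [h + 1], makes 0 and [h] interior points, so
   that the derivative is two-sided there. *)
pose F x := (\int[lebesgue_measure]_(t in `[(-1 : R), x]) f t)%R.
exists F => t; rewrite in_itv/= => /andP[t0 th].
have th1 : t < h + 1 by rewrite (le_lt_trans th)// ltrDl.
have int : lebesgue_measure.-integrable `[(-1 : R), h + 1] (EFin \o f).
  apply: continuous_compact_integrable; first exact: segment_compact.
  exact: continuous_subspaceT.
have t1 : -1 < t by rewrite (lt_le_trans _ t0)// ltrN10.
have [dF dE] := continuous_FTC1_closed th1 int t1 (cf t).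
by split=> //; rewrite -derive1E.
Qed.

(** The retraction of the line onto [[0, h]]: composing with it extends a function continuous on
    [[0, h]] to one continuous everywhere. *)
Definition clamp (h t : R) : R := Num.max 0 (Num.min t h).

Lemma clamp_itv (h t : R) : 0 < h -> clamp h t \in `[0, h].
Proof.
move=> h0; rewrite in_itv/= /clamp le_max lexx/= ge_max ltW//=.
by rewrite ge_min lexx orbT.
Qed.

Lemma clamp_id (h t : R) : t \in `[0, h] -> clamp h t = t.
Proof.
rewrite in_itv/= /clamp => /andP[t0 th].
by rewrite (min_l th) (max_r t0).
Qed.

Lemma clamp_continuous (h : R) : continuous (clamp h).
Proof.
move=> t; apply: (@continuous_max _ _ (cst 0) (fun t => Num.min t h)).
  exact: cst_continuous.
apply: (@continuous_min _ _ id (cst h)); last exact: cst_continuous.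
exact: cvg_id.
Qed.

(** Integrate [f] twice, then add an affine function to meet both boundary conditions. *)
Lemma scalar_bvp (h : R) (f : R -> R) (x0 : R) : 0 < h -> continuous f ->
  exists x y : R -> R, [/\ x 0 = x0, x h = x0,
    forall t, t \in `[0, h] -> is_derive t (1 : R) x (y t) &
    forall t, t \in `[0, h] -> is_derive t (1 : R) y (f t)].
Proof.
move=> h0 cf.
have [F dF] := antiderivative h0 cf.
have cF : continuous (F \o clamp h).
  move=> t; apply: continuous_comp; first exact: clamp_continuous.
  apply: differentiable_continuous; apply/derivable1_diffP.
  by have [] := dF _ (clamp_itv t h0).
have [P dP] := antiderivative h0 cF.
(* This slope gives [P t + v * t] the same value [P 0] at both ends; the constant in [x] then moves
   that value to [x0]. *)
pose v := (P 0 - P h) / h.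
pose x := P + (v \*: id) + cst (x0 - P 0).
pose y := F + cst v.
have xE t : x t = P t + v * t + (x0 - P 0) by [].
exists x, y; split.
- by rewrite xE mulr0 addr0 addrC subrK.
- by rewrite xE divfK ?gt_eqF// [P h + _]addrC subrK addrC subrK.
- move=> t th; have := dP t th; rewrite /= clamp_id// => dPt.
  have := is_deriveD (is_deriveD dPt (is_deriveZ v (is_derive_id t (1 : R))))
    (is_derive_cst (x0 - P 0) t (1 : R)).
  by rewrite addr0 [v *: 1]mulr1; exact.
- move=> t th; have := is_deriveD (dF t th) (is_derive_cst v t (1 : R)).
  by rewrite addr0; exact.
Qed.

Lemma rV_is_derive (n : nat) (x : R -> 'rV[R]_n) (y : 'rV[R]_n) (t : R) :
  (forall i, is_derive t (1 : R) (fun s => x s 0 i) (y 0 i)) ->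
  is_derive t (1 : R) x y.
Proof.
move=> dx.
have D : derivable x t 1 by apply/derivable_mxP => i j; rewrite ord1; have [] := dx j.
split=> //; rewrite derive_mx//; apply/rowP => i; rewrite !mxE.
by have [] := dx i.
Qed.

(** The problem decouples into its coordinates. Position and velocity are packed in a pair so that a
    single choice function can later select both. *)
Lemma linear_bvp (n : nat) (h : R) (a : R -> 'rV[R]_n) (x0 : 'rV[R]_n) :
  0 < h -> continuous a ->
  exists xy : (R -> 'rV[R]_n) * (R -> 'rV[R]_n), [/\ xy.1 0 = x0, xy.1 h = x0,
    forall t, t \in `[0, h] -> is_derive t (1 : R) xy.1 (xy.2 t) &
    forall t, t \in `[0, h] -> is_derive t (1 : R) xy.2 (a t)].
Proof.
move=> h0 ca.
have /choice[x Hx] (i : 'I_n) := scalar_bvp (x0 0 i) h0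
  (fun t => continuous_comp (ca t) (@coordf_continuous _ _ i (a t))).
have /choice[y Hy] := Hx.
exists (fun t => \row_i x i t, fun t => \row_i y i t); split=> /=.
- by apply/rowP => i; rewrite mxE; have [] := Hy i.
- by apply/rowP => i; rewrite mxE; have [] := Hy i.
- move=> t th; apply: rV_is_derive => i; rewrite mxE.
  have [_ _ d _] := Hy i; have := d t th; congr is_derive.
  by apply/funext => s; rewrite mxE.
- move=> t th; apply: rV_is_derive => i.
  have [_ _ _ d] := Hy i; have := d t th; congr is_derive.
  by apply/funext => s; rewrite mxE.
Qed.

End bvp.

(** * Existence and uniqueness of small loops by contraction *)

Section picard.
Context {R : realType}.

Lemma halving_small (c e : R) : 0 <= c -> 0 < e -> exists k, c / 2 ^+ k < e.
Proof.
move=> c0 e0; exists (Num.bound (c / e)).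
have ce : 0 <= c / e by rewrite divr_ge0// ltW.
rewrite ltr_pdivrMr ?exprn_gt0// mulrC -ltr_pdivrMr//.
apply: lt_trans (archi_boundP ce) _.
by rewrite -natrX ltr_nat ltn_expl.
Qed.

Lemma halving_le0 (c x : R) : (forall k, x <= c / 2 ^+ k) -> x <= 0.
Proof.
move=> H; rewrite leNgt; apply/negP => x0.
have c0 : 0 <= c by have := H 0%N; rewrite expr0 divr1; exact/le_trans/ltW.
by have [k] := halving_small c0 x0; rewrite ltNge H.
Qed.

Variables (n : nat) (x0 : 'rV[R]_n) (f : 'rV[R]_n * 'rV[R]_n -> 'rV[R]_n).
Local Notation E := 'rV[R]_n.
Variables (r K L h : R).
Local Notation inball z := (`|z - (x0, 0)| <= r).
Hypothesis L_ge0 : 0 <= L.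
Hypothesis f_bound : forall z, inball z -> `|f z| <= K.
Hypothesis f_lip : forall z w,
  inball z -> inball w -> `|f z - f w| <= L * `|z - w|.
Hypotheses (h_gt0 : 0 < h) (h_le1 : h <= 1).
Hypotheses (Kh : K * h <= r) (Lh : L * h <= 1 / 2).

(** The acceleration [a] is kept free: Picard iterates use an arbitrary one, and solutions are the
    case [a t = f (x t, y t)]. Relative derivatives are all that a trajectory on [[0, h]]
    provides. *)
Definition loop_pair (a x y : R -> E) :=
  [/\ x 0 = x0, x h = x0,
      forall t, t \in `[0, h] -> wderiv `[0, h] x t (y t) &
      forall t, t \in `[0, h] -> wderiv `[0, h] y t (a t)].

Lemma loop_pair_inball a x y : loop_pair a x y ->
  (forall t, t \in `[0, h] -> `|a t| <= K) ->
  forall t, t \in `[0, h] -> inball (x t, y t).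
Proof.
move=> [x0E xhE dx dy] aK t th.
have [yK xK] := loop_bounds h_gt0 dx dy (etrans x0E (esym xhE)) aK th.
have K0 : 0 <= K by apply: le_trans (aK t th).
(* The velocity bound is [K * h <= r]; the position bound [K * h * h] is no larger because
   [h <= 1]. *)
rewrite prod_normE ge_max /= subr0 (le_trans yK)// andbT -{1}x0E (le_trans xK)//.
by rewrite (le_trans _ Kh)// ler_piMr// mulr_ge0// ltW.
Qed.

(** The difference of the two loops is a loop at 0 with acceleration bounded by [M], so the pairs
    are within [M * h] of each other; [L * h <= 1 / 2] then halves the bound on the
    accelerations. *)
Lemma loop_pair_contract a b x y x' y' (M : R) :
  loop_pair a x y -> loop_pair b x' y' ->
  (forall t, t \in `[0, h] -> inball (x t, y t)) ->
  (forall t, t \in `[0, h] -> inball (x' t, y' t)) ->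
  (forall t, t \in `[0, h] -> `|a t - b t| <= M) ->
  forall t, t \in `[0, h] -> `|(x t, y t) - (x' t, y' t)| <= M /\
    `|f (x t, y t) - f (x' t, y' t)| <= M / 2.
Proof.
move=> [x0E xhE dx dy] [x0E' xhE' dx' dy'] xyr xyr' abM t th.
have M0 : 0 <= M by apply: le_trans (abM t th).
have Mh0 : 0 <= M * h by rewrite mulr_ge0// ltW.
have [yM xM] := @loop_bounds _ _ h M (x \- x') (y \- y') (a \- b) h_gt0
  (fun s sh => wderivB (dx s sh) (dx' s sh))
  (fun s sh => wderivB (dy s sh) (dy' s sh))
  (etrans (congr2 (fun p q => p - q) x0E x0E')
     (esym (congr2 (fun p q => p - q) xhE xhE'))) abM t th.
have D : `|(x t, y t) - (x' t, y' t)| <= M * h.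
  rewrite prod_normE ge_max /= yM andbT.
  move: xM; rewrite /= x0E x0E' subrr subr0 => /le_trans; apply.
  by rewrite ler_piMr.
split; first by rewrite (le_trans D)// ler_piMr.
apply: le_trans (f_lip (xyr t th) (xyr' t th)) _.
apply: le_trans (ler_wpM2l L_ge0 D) _.
by rewrite mulrCA ler_wpM2l// -[leRHS]div1r.
Qed.

(** Here the accelerations are the values of [f] themselves, so the contraction can be repeated from
    the crude bound [K + K], halving it each time. *)
Lemma loop_unique x y x' y' :
  loop_pair (fun t => f (x t, y t)) x y ->
  loop_pair (fun t => f (x' t, y' t)) x' y' ->
  (forall t, t \in `[0, h] -> inball (x t, y t)) ->
  (forall t, t \in `[0, h] -> inball (x' t, y' t)) ->
  forall t, t \in `[0, h] -> (x t, y t) = (x' t, y' t).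
Proof.
move=> xy xy' xyr xyr'.
have H k t : t \in `[0, h] ->
    `|f (x t, y t) - f (x' t, y' t)| <= (K + K) / 2 ^+ k.
  elim: k t => [|k IH] t th.
    rewrite expr0 divr1 (le_trans (ler_normB _ _))// lerD// f_bound//.
      exact: xyr.
    exact: xyr'.
  have [_] := loop_pair_contract xy xy' xyr xyr' IH th.
  by rewrite exprS invfM mulrA mulrAC.
move=> t th; apply/eqP; rewrite -subr_eq0 -normr_le0.
apply: (@halving_le0 (K + K)) => k.
by have [] := loop_pair_contract xy xy' xyr xyr' (H k) th.
Qed.

Hypothesis f_cont : forall z, inball z -> {for z, continuous f}.
Hypothesis K_ge0 : 0 <= K.

Lemma loop_exists : exists x y : R -> E,
  [/\ x 0 = x0, x h = x0,
      forall t, t \in `[0, h] -> inball (x t, y t),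
      forall t, t \in `[0, h] -> is_derive t (1 : R) x (y t) &
      forall t, t \in `[0, h] -> is_derive t (1 : R) y (f (x t, y t))].
Proof.
(* Picard iteration on the acceleration [a]: [S a] solves the linear problem
   x'' = a, and [clamp] makes every iterate continuous on the whole line. *)
have /choice[S HS] (a : R -> E) : exists xy : (R -> E) * (R -> E),
    continuous a -> [/\ xy.1 0 = x0, xy.1 h = x0,
    forall t, t \in `[0, h] -> is_derive t (1 : R) xy.1 (xy.2 t) &
    forall t, t \in `[0, h] -> is_derive t (1 : R) xy.2 (a t)].
  (* The choice function must be total; for discontinuous [a] the value is arbitrary. *)
  have [ca|nca] := pselect (continuous a); last by exists (a, a).
  by have [xy Hxy] := linear_bvp x0 h_gt0 ca; exists xy.
pose T a t := f ((S a).1 (clamp h t), (S a).2 (clamp h t)).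
(* The complete set on which [T] acts as a contraction for the uniform distance. *)
pose good (a : R -> E) := continuous a /\ forall t, `|a t| <= K.
have Spair (a : R -> E) : continuous a -> loop_pair a (S a).1 (S a).2.
  move=> /HS[s0 sh ds1 ds2].
  by split=> // t th; apply: is_derive_wderiv; [exact: ds1|exact: ds2].
have Sball a : good a -> forall t, t \in `[0, h] -> inball ((S a).1 t, (S a).2 t).
  by move=> [ca aK]; apply: loop_pair_inball (Spair _ ca) _ => t _.
have Tgood a : good a -> good (T a).
  move=> ga; split=> [t|t]; last first.
    by apply: f_bound; apply: Sball => //; exact: clamp_itv.
  have tc := clamp_itv t h_gt0.
  have [_ _ ds1 ds2] := HS a ga.1.
  apply: (@continuous_comp _ _ _
    (fun t => ((S a).1 (clamp h t), (S a).2 (clamp h t))) f); last first.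
    by apply: f_cont; exact: Sball.
  have c1 : {for t, continuous ((S a).1 \o clamp h)}.
    apply: continuous_comp; first exact: clamp_continuous.
    by apply: differentiable_continuous; apply/derivable1_diffP; have [] := ds1 _ tc.
  have c2 : {for t, continuous ((S a).2 \o clamp h)}.
    apply: continuous_comp; first exact: clamp_continuous.
    by apply: differentiable_continuous; apply/derivable1_diffP; have [] := ds2 _ tc.
  exact: (cvg_pair c1 c2).
have Tcontract a b M : good a -> good b -> (forall t, `|a t - b t| <= M) ->
    forall t, `|T a t - T b t| <= M / 2.
  move=> ga gb abM t.
  by have [] := loop_pair_contract (Spair _ ga.1) (Spair _ gb.1) (Sball _ ga)
     (Sball _ gb) (fun t _ => abM t) (clamp_itv t h_gt0).
pose A k := iter k T (cst 0).
have gA k : good (A k).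
  elim: k => [|k IH]; last exact: Tgood.
  by split=> [|t]; [exact: cst_continuous|rewrite /= normr0].
have dA k t : `|A k.+1 t - A k t| <= K / 2 ^+ k.
  elim: k t => [|k IH] t.
    by rewrite /A/= subr0 expr0 divr1; have [_] := gA 1%N; exact.
  apply: le_trans (Tcontract _ _ _ (gA k.+1) (gA k) IH t) _.
  by rewrite exprS invfM mulrA mulrAC.
have dA2 k j t : `|A (j + k)%N t - A k t| <= (K + K) / 2 ^+ k.
  (* The subtracted term is the unspent tail of the geometric series, which makes the induction on
     [j] close. *)
  have H : `|A (j + k)%N t - A k t| <= (K + K) / 2 ^+ k - (K + K) / 2 ^+ (j + k).
    elim: j => [|j IH]; first by rewrite add0n !subrr normr0.
    rewrite -(subrK (A (j + k)%N t) (A (j.+1 + k)%N t)) -addrA.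
    apply: le_trans (ler_normD _ _) _.
    apply: le_trans (lerD (dA _ _) IH) _.
    rewrite addSn exprS invfM.
    set u := (2 ^+ (j + k))^-1; set w := (2 ^+ k)^-1.
    lra.
  by rewrite (le_trans H)// gerBl divr_ge0 ?addr_ge0// exprn_ge0.
have cA t : cvg (A k t @[k --> \oo]).
  apply/cauchy_cvgP; apply/cauchy_exP => e e0.
  have [k ke] := halving_small (addr_ge0 K_ge0 K_ge0) e0.
  exists (A k t); exists k => // m /= km.
  rewrite -ball_normE /= distrC -(subnK km).
  exact: le_lt_trans (dA2 _ _ _) ke.
pose a t := lim (A k t @[k --> \oo]).
have aA k t : `|a t - A k t| <= (K + K) / 2 ^+ k.
  apply/ler_addgt0Pr => e e0.
  have /cvgrPdist_lt /(_ e e0) [N _ HN] : A k t @[k --> \oo] --> a t by exact: cA.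
  have := HN (N + k)%N (leq_addr _ _) => /= HNk.
  rewrite -(subrK (A (N + k)%N t) (a t)) -addrA.
  by apply: le_trans (ler_normD _ _) _; rewrite [leRHS]addrC lerD// ltW.
have ga : good a.
  split=> [t|t].
    apply/cvgrPdist_lt => e e0.
    (* A uniform limit of continuous functions is continuous: two tails and one increment of [A k],
       each below [e / 4]. *)
    have e4 : 0 < e / 4 by rewrite divr_gt0.
    have [k ke] := halving_small (addr_ge0 K_ge0 K_ge0) e4.
    have /cvgrPdist_lt /(_ _ e4) := (gA k).1 t.
    apply: filterS => s Hs.
    have -> : a t - a s = (a t - A k t) + (A k t - A k s) + (A k s - a s).
      by rewrite !addrA !subrK.
    have H1 := aA k t; have H2 := aA k s; rewrite distrC in H2.
    have := ler_normD (a t - A k t + (A k t - A k s)) (A k s - a s).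
    have := ler_normD (a t - A k t) (A k t - A k s).
    lra.
  apply/ler_addgt0Pr => e e0.
  have [k ke] := halving_small (addr_ge0 K_ge0 K_ge0) e0.
  rewrite -(subrK (A k t) (a t)); apply: le_trans (ler_normD _ _) _.
  by rewrite [leRHS]addrC lerD//; [rewrite (le_trans (aA k t))// ltW|exact: (gA k).2].
have Ta t : T a t = a t.
  apply/eqP; rewrite -subr_eq0 -normr_le0; apply: (@halving_le0 (K + K)) => k.
  (* Since [A k.+1 = T (A k)], both [T a] and [a] are close to [A k.+1]: each distance is at most
     [(K + K) / 2 ^+ k.+1]. *)
  rewrite -(subrK (A k.+1 t) (T a t)) -addrA; apply: le_trans (ler_normD _ _) _.
  have H1 := Tcontract _ _ _ ga (gA k) (aA k) t.
  have H2 := aA k.+1 t; rewrite distrC in H2.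
  apply: le_trans (lerD H1 H2) _.
  rewrite exprS invfM; set u := (2 ^+ k)^-1; lra.
have [x0E xhE dx dy] := HS a ga.1.
exists (S a).1, (S a).2; split=> //; first exact: Sball.
move=> t th; have := dy t th; rewrite -{1}Ta /T clamp_id//.
Qed.

End picard.

(** * Trajectories in a chart *)

Section geometry.
Context {R : realType}.

Lemma is_derive_comp (V W : normedModType R) (g : V -> W) (u : R -> V) t l :
  differentiable g (u t) -> is_derive t (1 : R) u l ->
  is_derive t (1 : R) (g \o u) ('d g (u t) l).
Proof.
move=> dg [du dE].
have du' : differentiable u t by exact/derivable1_diffP.
have dgu : differentiable (g \o u) t by exact: differentiable_comp.
split; first exact/derivable1_diffP.
by rewrite -dE !deriveE// [LHS](congr1 (@^~ 1) (diff_comp du' dg)).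
Qed.

Lemma is_derive_pair (V W : normedModType R) (u : R -> V) (w : R -> W) t l k :
  is_derive t (1 : R) u l -> is_derive t (1 : R) w k ->
  is_derive t (1 : R) (fun s => (u s, w s)) (l, k).
Proof.
move=> [du lE] [dw kE].
have du' : differentiable u t by exact/derivable1_diffP.
have dw' : differentiable w t by exact/derivable1_diffP.
have dp := differentiable_pair du' dw'.
split; first exact/derivable1_diffP.
by rewrite -lE -kE !deriveE// (congr1 (@^~ 1) (diff_pair du' dw')).
Qed.

(** A velocity is tested in every chart around the point; one chart suffices, because the chain rule
    for transition maps matches the law relating the components. *)
Lemma is_velocity_chart (V : normedModType R) (M : topologicalType)
    (A : atlas V M) (J : set R) (i : chart_index A) (u : R -> V) t
    (v : tbundle A) :
  (chart_map A i @` chart_dom A i) (u t) -> tbase v = chart_inv A i (u t) ->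
  is_derive t (1 : R) u (tcomp v i) -> is_velocity J (chart_inv A i \o u) t v.
Proof.
move=> ut bv du.
have [q iq qut] := ut.
have iq' : chart_dom A i (chart_inv A i (u t)) by rewrite -qut chart_mapK.
have utE : chart_map A i (chart_inv A i (u t)) = u t by rewrite -qut chart_mapK.
split=> //.
  have c : {for t, continuous (chart_inv A i \o u)}.
    apply: continuous_comp; last exact: chart_inv_cont.
    by apply: differentiable_continuous; apply/derivable1_diffP; have [] := du.
  by apply: cvg_trans c; apply: cvg_app; exact: cvg_within.
move=> j jt; apply: (@is_derive_wderiv _ _ _ (chart_map A j \o chart_inv A i \o u)).
rewrite (@tcomp_trans _ _ _ _ v i j) ?bv// utE.
apply: is_derive_comp du.
by have := tr_differentiable iq' jt; rewrite utE.
Qed.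

Lemma C1_linear_comp (V W X : normedModType R) (U : set V) (g : V -> W)
    (l : {linear W -> X}) :
  open U -> continuous l -> Ck 1 U g -> Ck 1 U (l \o g).
Proof.
move=> oU cl [dg cg].
have dl z : differentiable l z by exact: linear_differentiable.
split=> [z Uz|v]; first by apply: differentiable_comp; [exact: dg|exact: dl].
apply: (@eq_Ck _ 0%N _ _ _ (l \o (fun z => 'd g z v))) => //.
  move=> z Uz; rewrite [RHS](congr1 (@^~ v) (diff_comp (dg z Uz) (dl _))) /=.
  by rewrite (congr1 (@^~ _) (diff_lin _ cl)).
by move=> z Uz; apply: continuous_comp; [exact: cg|exact: cl].
Qed.

Lemma compact_norm_ball n (x0 : 'rV[R]_n) (r : R) :
  0 < r -> compact [set x | `|x - x0| <= r].
Proof.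
move=> r0; apply: bounded_closed_compact.
  exists (`|x0| + r); split; first exact: num_real.
  move=> N rN x /= xr; rewrite -(subrK x0 x) (le_trans (ler_normD _ _))//.
  by rewrite addrC (le_trans _ (ltW rN))// lerD2l.
rewrite (_ : mkset _ = closed_ball_ Num.norm x0 r); first exact: closed_closed_ball_.
by apply/seteqP; split=> x; rewrite /closed_ball_/= distrC.
Qed.

Lemma compact_norm_ball2 n (x0 y0 : 'rV[R]_n) (r : R) :
  0 < r -> compact [set z : 'rV[R]_n * 'rV[R]_n | `|z - (x0, y0)| <= r].
Proof.
move=> r0.
rewrite (_ : mkset _ = [set x | `|x - x0| <= r] `*` [set y | `|y - y0| <= r]).
  by apply: compact_setX; exact: compact_norm_ball.
by apply/seteqP; split=> -[x y]; rewrite /= prod_normE ge_max /= => /andP.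
Qed.

(** * Second-order fields and their trajectories in one chart *)

Section sode.
Variables (n : nat) (Q : manifold R n).
Variable Gamma : tangent Q -> tbundle (tangent_atlas Q).
Hypothesis hGamma : is_SODE Gamma.
Local Notation E := 'rV[R]_n.
Local Notation A := (mfd_atlas Q).
Variable i : chart_index A.
Local Notation phi := (chart_map A i).
Local Notation psi := (chart_inv A i).
Local Notation dom := (chart_dom A i).

(** The coefficients of [Gamma] along the fibre coordinates, that is, the right-hand side of the
    local equation. The tangent atlas has the same indices as the atlas of [Q], so [i] serves for
    both. *)
Definition sode_accel (z : E * E) : E := (tcomp (Gamma (tinv i z)) i).2.

Let Gamma_base v : tbase (Gamma v) = v.
Proof. by have [[]] := hGamma. Qed.

(** In charts the tangent projection is [fst] near [tmap i v], so its differential is [fst] too, and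
    the second-order condition fixes the first component. *)
Lemma sode_chartE (v : tangent Q) : dom (tbase v) ->
  tcomp (Gamma v) i = (tcomp v i, sode_accel (tmap i v)).
Proof.
move=> iv; rewrite /sode_accel tmapK// [LHS]surjective_pairing; congr pair.
have [_ /(_ v)[_ /(_ i i)]] := hGamma.
rewrite Gamma_base => /(_ iv iv) ->.
have e : {near tmap i v, fst =1 phi \o @tangent_proj R n Q \o tinv i}.
  have o : open ((phi @` dom) \o (@fst E E)) by apply: open_fst; exact: chart_img_open.
  have : nbhs (tmap i v) ((phi @` dom) \o (@fst E E)).
    by apply: open_nbhs_nbhs; split=> //; exists (tbase v).
  apply: filterS => z [q iq qz] /=.
  by rewrite /tangent_proj /= -qz chart_mapK.
have cfst : continuous [the {linear _ -> _} of @fst E E] by move=> z; exact: cvg_fst.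
have [_ ->] := near_eq_diff e (@linear_differentiable _ _ _ _ _ cfst).
by rewrite diff_lin.
Qed.

Lemma sode_accel_C1 : Ck 1 (@tmap _ _ _ A i @` tdom i) sode_accel.
Proof.
have [[_ /(_ i 1%N) CG] _] := hGamma.
apply: (@C1_linear_comp _ _ _ _ _ [the {linear _ -> _} of @snd E E] _ _ CG).
  exact: timg_open.
by move=> z; exact: cvg_snd.
Qed.

Lemma trajectory_of_chart (h : R) (x y : R -> E) :
  (forall t, t \in `[0, h] -> (phi @` dom) (x t)) ->
  (forall t, t \in `[0, h] -> is_derive t (1 : R) x (y t)) ->
  (forall t, t \in `[0, h] -> is_derive t (1 : R) y (sode_accel (x t, y t))) ->
  velocity_curve `[0, h] (psi \o x : R -> Q) (fun t => tinv i (x t, y t)) /\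
  integral_curve Gamma `[0, h] (fun t => tinv i (x t, y t)).
Proof.
move=> xd dx dy; split=> t th.
- have [td tE] := @tinvK _ _ _ A i (x t, y t) (xd t th).
  apply: is_velocity_chart => //; first exact: xd.
  by have := congr1 snd tE => /= ->; exact: dx.
- have [td tE] := @tinvK _ _ _ A i (x t, y t) (xd t th).
  apply: (@is_velocity_chart _ _ (tangent_atlas Q) _ i (fun t => (x t, y t))).
  + by exists (tinv i (x t, y t)).
  + by rewrite Gamma_base.
  + rewrite sode_chartE// tE; have -> : tcomp (tinv i (x t, y t)) i = y t.
      by have := congr1 snd tE.
    by apply: is_derive_pair; [exact: dx|exact: dy].
Qed.

Lemma chart_of_trajectory (h : R) (sigma : R -> Q) (dsigma : R -> tangent Q) :
  velocity_curve `[0, h] sigma dsigma -> integral_curve Gamma `[0, h] dsigma ->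
  (forall t, t \in `[0, h] -> dom (sigma t)) ->
  let x t := phi (sigma t) in let y t := tcomp (dsigma t) i in
  (forall t, t \in `[0, h] -> wderiv `[0, h] x t (y t)) /\
  (forall t, t \in `[0, h] -> wderiv `[0, h] y t (sode_accel (x t, y t))).
Proof.
move=> vs is_ sd x y; split=> t th; first by have [_ _] := vs t th; apply; exact: sd.
have [bt _ _] := vs t th.
have dt : dom (tbase (dsigma t)) by rewrite bt; exact: sd.
have [_ _ /(_ i dt)] := is_ t th.
rewrite sode_chartE// => D.
have csnd : continuous [the {linear _ -> _} of @snd E E] by move=> z; exact: cvg_snd.
by have := wderiv_linear csnd D; rewrite /= /tmap bt.
Qed.

(** [loop_trajectory] quantifies separately over the lift that integrates [Gamma] and the lift that
    stays in [Cbar]; this identifies them on [[0, h]]. Components in charts away from the point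
    agree because they are 0. *)
Lemma velocity_curve_unique (h : R) (sigma : R -> Q) (d1 d2 : R -> tangent Q) :
  0 < h -> velocity_curve `[0, h] sigma d1 -> velocity_curve `[0, h] sigma d2 ->
  forall t, t \in `[0, h] -> d1 t = d2 t.
Proof.
move=> h0 v1 v2 t th; have [b1 _ l1] := v1 t th; have [b2 _ l2] := v2 t th.
apply: tbundle_ext; first by rewrite b1 b2.
apply/funext => j; have [jt|jt] := pselect (chart_dom A j (sigma t)).
  exact: wderiv_unique h0 th (l1 j jt) (l2 j jt).
by rewrite !tcomp_out ?b1 ?b2.
Qed.

End sode.
End geometry.

(** * Closed trajectories on the manifold *)

Theorem theorem2p1 (R : realType) (n : nat) (Q : manifold R n)
    (Gamma : tangent Q -> tbundle (tangent_atlas Q)) (hGamma : is_SODE Gamma)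
    (q0 : Q) :
  exists (h0 : R) (v : R -> tangent Q) (C : set Q) (Cbar : set (tangent Q)),
    [/\ 0 < h0,
        forall h : R, 0 < h <= h0 -> tangent_proj (v h) = q0,
        compact C /\ compact Cbar,
        C q0 /\ (forall h : R, 0 < h <= h0 -> Cbar (v h)) &
        forall h : R, 0 < h <= h0 ->
          exists2 sigma : R -> Q,
            loop_trajectory Gamma q0 C Cbar h sigma &
            forall sigma' : R -> Q,
              loop_trajectory Gamma q0 C Cbar h sigma' ->
              forall t : R, t \in `[0, h] -> sigma' t = sigma t].
Proof.
have [i iq0] := chart_cover (mfd_atlas Q) q0.
pose phi := chart_map (mfd_atlas Q) i; pose psi := chart_inv (mfd_atlas Q) i.
pose dom := chart_dom (mfd_atlas Q) i.
pose U := @tmap _ _ _ (mfd_atlas Q) i @` tdom i.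
have oU : open U by exact: timg_open.
pose x0 := phi q0.
have Uphi z : U z -> (phi @` dom) z.1.
  by move=> [v iv <-]; exists (tbase v).
have Uz0 : U (x0, 0).
  have [|td tE] := @tinvK _ _ _ (mfd_atlas Q) i (x0, 0); first by exists q0.
  by exists (tinv i (x0, 0)).
have C1 := sode_accel_C1 hGamma i.
have [r [K [L [[r0 K0 L0] rU rK rL]]]] := C1_locally_lipschitz2 oU Uz0 C1.
set f := sode_accel Gamma i in C1 rK rL.
have fc z : `|z - (x0, 0)| <= r -> {for z, continuous f}.
  by move=> /rU Uz; exact: (CkS C1) Uz.
(* The three terms give [h <= 1], [K * h <= r] and [L * h <= 1 / 2]; adding 1 to [K] and [L], which
   may vanish, keeps the denominators positive. *)
pose h0 := Num.min 1 (Num.min (r / (K + 1)) (1 / (2 * (L + 1)))).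
have K1 : 0 < K + 1 by rewrite ltr_wpDl.
have L1 : 0 < L + 1 by rewrite ltr_wpDl.
have h0_gt0 : 0 < h0.
  by rewrite !lt_min ltr01 !divr_gt0// mulr_gt0.
have hP h : 0 < h <= h0 -> [/\ 0 < h, h <= 1, K * h <= r & L * h <= 1 / 2].
  rewrite !le_min => /and4P[hp h1 hr hL]; split=> //.
    move: hr; rewrite ler_pdivlMr// => /(le_trans _); apply.
    by rewrite mulrDr mulr1 mulrC lerDl ltW.
  move: hL; rewrite ler_pdivlMr ?mulr_gt0// => hL.
  by nra.
pose C := psi @` [set x | `|x - x0| <= r].
pose Cbar := @tinv _ _ _ (mfd_atlas Q) i @` [set z | `|z - (x0, 0)| <= r].
have rfst x : `|x - x0| <= r -> (phi @` dom) x.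
  move=> xr; apply: (Uphi (x, 0)); apply: rU.
  by rewrite prod_normE ge_max /= xr subrr normr0 ltW.
have psix0 : psi x0 = q0 by exact: chart_mapK.
(* The family [v] only has to lie over [q0] and in [Cbar]. *)
exists h0, (fun=> tinv i (x0, 0)), C, Cbar; split=> //.
- split; apply: continuous_compact.
  + apply: continuous_in_subspaceT => x; rewrite inE /= => xr.
    by apply: chart_inv_cont; exact: rfst.
  + exact: compact_norm_ball.
  + apply: continuous_in_subspaceT => z; rewrite inE /= => zr.
    by apply: tinv_cont; exact: rU.
  + exact: compact_norm_ball2.
- split=> [|h _]; first by exists x0 => //=; rewrite subrr normr0 ltW.
  by exists (x0, 0) => //=; rewrite subrr normr0 ltW.
move=> h /hP[hp h1 Kh Lh].
have [x [y [xx0 xh xr dx dy]]] := loop_exists L0 rK rL hp h1 Kh Lh fc K0.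
have xd t : t \in `[0, h] -> (phi @` dom) (x t).
  by move=> th; apply: (Uphi (x t, y t)); apply: rU; exact: xr.
have [vs ic] := trajectory_of_chart hGamma xd dx dy.
exists (psi \o x).
  split; rewrite /= ?xx0 ?xh//.
  - by exists (fun t => tinv i (x t, y t)).
  - move=> t th; exists (x t) => //=.
    by have := xr t th; rewrite prod_normE ge_max /= => /andP[].
  - exists (fun t => tinv i (x t, y t)) => // t th.
    by exists (x t, y t) => //; exact: xr.
move=> sigma' [[d1 v1 ic1] _ s0 sh [d2 v2 d2C]] t th.
have d1C s : s \in `[0, h] -> Cbar (d1 s).
  by move=> hs; rewrite (velocity_curve_unique hp v1 v2 hs); exact: d2C.
have base s : s \in `[0, h] -> tbase (d1 s) = sigma' s by move=> /v1[].
(* Staying in [Cbar] forces any competitor into the domain of chart [i], with coordinates in the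
   ball, so uniqueness can be decided in this one chart. *)
have loc s : s \in `[0, h] -> dom (sigma' s) /\
    `|(phi (sigma' s), tcomp (d1 s) i) - (x0, 0)| <= r.
  move=> hs; have [z zr zE] := d1C s hs.
  have [td tE] := @tinvK _ _ _ (mfd_atlas Q) i z (Uphi _ (rU _ zr)).
  rewrite -(base s hs) -[(_, _)]/(tmap i (d1 s)) -zE tE; split=> //.
have [dx' dy'] := chart_of_trajectory hGamma v1 ic1 (fun s hs => (loc s hs).1).
have lp : loop_pair x0 h (fun s => f (x s, y s)) x y.
  by split=> // s hs; apply: is_derive_wderiv; [exact: dx|exact: dy].
have lp' : loop_pair x0 h (fun s => f (phi (sigma' s), tcomp (d1 s) i))
    (phi \o sigma') (fun s => tcomp (d1 s) i).
  by split=> //=; rewrite ?s0 ?sh.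
have [/= -> _] := loop_unique L0 rK rL hp h1 Lh lp lp' xr
  (fun s hs => (loc s hs).2) th.
by rewrite /psi /phi chart_mapK//; exact: (loc t th).1.
Qed.
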